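(* Let $d\in\{1,2\}$ and suppose $V:\mathbb{R}^d\to\mathbb{R}$ is a measurable function such that $\liminf_{\alpha\downarrow\frac d2}\|V\|_{\mathcal{R}_{d,\alpha}}<\infty$. Then for any choice of $\varepsilon,r>0$ and $x\in\mathbb{R}^d$ there is no ball $B_r(x)$ such that $|V(y)|>\varepsilon$ for a.e. $y\in B_r(x)$. In particular, if $V$ is continuous, then $V\equiv0$.
   Context: For $\alpha\in(0,2)$ with $\alpha<d<2\alpha$ and measurable $V$, $\|V\|_{\mathcal{R}_{d,\alpha}}\in[0,\infty]$ is defined by $$\|V\|^2_{\mathcal{R}_{d,\alpha}}=\int_{\mathbb{R}^d}\int_{\mathbb{R}^d}\frac{|V(x)||V(y)|}{|x-y|^{2(d-\alpha)}}\,dx\,dy .$$ $B_r(x)\subset\mathbb{R}^d$ denotes the ball of radius $r$ centred at $x$. *)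

(* Defs.v *)
From HB Require Import structures.
From mathcomp Require Import all_boot all_order all_algebra.
From mathcomp Require Import all_classical all_reals all_analysis.

Set Implicit Arguments.
Unset Strict Implicit.
Unset Printing Implicit Defensive.

Import Order.TTheory GRing.Theory Num.Theory.
Import numFieldNormedType.Exports.

Local Open Scope classical_set_scope.
Local Open Scope ring_scope.

Section lebesgue_measure_Rd.
Variables (R : realType) (d : nat).
Local Open Scope ereal_scope.
Implicit Types A : set 'rV[R]_d.

Definition box (a b : 'rV[R]_d) : set 'rV[R]_d :=
  [set x | forall i, (a ord0 i <= x ord0 i <= b ord0 i)%R].

Definition box_volume (a b : 'rV[R]_d) : R := (\prod_i (b ord0 i - a ord0 i))%R.

(* The boxes are indexed by a set [P] of naturals so that finite covers, and in
   particular the empty cover of [set0], are allowed in every dimension. *)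
Definition box_cover A (P : pred nat) (a b : nat -> 'rV[R]_d) : Prop :=
  (forall k i, (a k ord0 i <= b k ord0 i)%R) /\
  A `<=` \bigcup_(k in [set k | P k]) box (a k) (b k).

Definition lebesgue_outer A : \bar R :=
  ereal_inf [set s | exists P a b, box_cover A P a b /\
    s = \sum_(k <oo | P k) (box_volume (a k) (b k))%:E].

Let volume_ge0 A P a b k : box_cover A P a b ->
  0 <= (box_volume (a k) (b k))%:E.
Proof.
by move=> [ab _]; rewrite lee_fin; apply: prodr_ge0 => i _; rewrite subr_ge0.
Qed.

Lemma lebesgue_outer_ge0 A : 0 <= lebesgue_outer A.
Proof.
apply: le_ereal_inf_tmp => _ [P [a [b [cov ->]]]].
by apply: nneseries_ge0 => k _ _; exact: volume_ge0 cov.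
Qed.

Lemma lebesgue_outer0 : lebesgue_outer set0 = 0.
Proof.
apply/eqP; rewrite eq_le lebesgue_outer_ge0 andbT.
apply: ereal_inf_lbound; exists pred0, (fun=> 0%R), (fun=> 0%R); split.
  by split.
by rewrite eseries_pred0.
Qed.

Lemma le_lebesgue_outer :
  {homo lebesgue_outer : A B / A `<=` B >-> A <= B}.
Proof.
move=> A B AB; apply: ereal_inf_le_tmp => _ [P [a [b [[ab BU] ->]]]].
by exists P, a, b; split => //; split => //; exact: subset_trans BU.
Qed.

Lemma lebesgue_outer_sigma_subadditive : sigma_subadditive lebesgue_outer.
Proof.
move=> A; have [[i ioo]|] := pselect (exists i, lebesgue_outer (A i) = +oo).
  rewrite (eseries_pinfty _ _ ioo) ?leey// => n _.
  by rewrite -ltNye (lt_le_trans _ (lebesgue_outer_ge0 _)).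
rewrite -forallNE => Aoo.
apply/lee_addgt0Pr => e e0.
rewrite (le_trans _ (epsilon_trick _ _ (ltW e0)))//; last first.
  by move=> n; exact: lebesgue_outer_ge0.
pose C n (c : pred nat * (nat -> 'rV[R]_d) * (nat -> 'rV[R]_d)) :=
  box_cover (A n) c.1.1 c.1.2 c.2 /\
  \sum_(k <oo | c.1.1 k) (box_volume (c.1.2 k) (c.2 k))%:E <=
    lebesgue_outer (A n) + (e / (2 ^ n.+1)%:R)%:E.
have [G CG] : {G & forall n, C n (G n)}.
  apply: (@choice _ _ C) => n; rewrite /C.
  have en0 : (0 < e / (2 ^ n.+1)%:R :> R)%R by rewrite divr_gt0.
  have fA : lebesgue_outer (A n) \is a fin_num.
    by rewrite ge0_fin_numE ?lebesgue_outer_ge0// ltey; exact/eqP/Aoo.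
  have [_ [P [a [b [cov ->]]]] lt] := lb_ereal_inf_adherent en0 fA.
  by exists (P, a, b); split => //; exact: ltW.
pose v n k := (box_volume ((G n).1.2 k) ((G n).2 k))%:E.
have v0 n k : 0 <= v n k by exact: volume_ge0 (CG n).1.
pose J n := [set k | (G n).1.1 k].
apply: (@le_trans _ _ (\sum_(n <oo) \sum_(k <oo | (G n).1.1 k) v n k)).
  rewrite nneseries_esumT; last by move=> n; exact: nneseries_ge0.
  rewrite (eq_esum (b := fun n => \esum_(k in J n) v n k)); last first.
    by move=> n _; rewrite nneseries_esum.
  rewrite esum_esum//.
  have /card_esym/ppcard_eqP[f] := card_nat2.
  rewrite (@reindex_esum _ _ _ [set m | (G (f m).1).1.1 (f m).2] _ f); last first.
    split.
    - by move=> m.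
    - by move=> m m' _ _ /(@inj _ _ _ f); apply; rewrite inE.
    - move=> [n k] /= [_ nk]; exists (f^-1%FUN (n, k)); last by rewrite invK ?inE.
      by rewrite /= invK ?inE.
  rewrite -(@nneseries_esum _ (fun m => v (f m).1 (f m).2)
    (fun m => (G (f m).1).1.1 (f m).2))//.
  apply: ereal_inf_lbound.
  exists (fun m => (G (f m).1).1.1 (f m).2), (fun m => (G (f m).1).1.2 (f m).2),
    (fun m => (G (f m).1).2 (f m).2); split => //; split.
    by move=> m i; exact: (CG _).1.1.
  move=> x [n _ /(CG n).1.2 [k nk bx]].
  by exists (f^-1%FUN (n, k)); rewrite /= invK ?inE.
apply: lee_nneseries => n _; last exact: (CG n).2.
by move=> _; exact: nneseries_ge0.
Qed.

HB.instance Definition _ := isOuterMeasure.Build R 'rV[R]_d lebesgue_outer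
  lebesgue_outer0 lebesgue_outer_ge0 le_lebesgue_outer
  lebesgue_outer_sigma_subadditive.

(* R^d equipped with the Lebesgue (not merely Borel) sigma-algebra. *)
Definition lebesgueRd := caratheodory_type lebesgue_outer.
HB.instance Definition _ := Measurable.on lebesgueRd.

(* Lebesgue measure: the restriction of the outer measure above to its
   Caratheodory-measurable sets. *)
Definition lebesgue_measureRd : set lebesgueRd -> \bar R := lebesgue_outer.
HB.instance Definition _ := isMeasure.Build _ lebesgueRd R lebesgue_measureRd
  (@caratheodory_measure0 _ _ _) (@caratheodory_measure_ge0 _ _ _)
  (@caratheodory_measure_sigma_additive _ _ _).

End lebesgue_measure_Rd.
Arguments lebesgue_measureRd : clear implicits.

(* The library norm on row vectors is the sup norm. *)
Definition enorm (R : realType) (d : nat) (x : 'rV[R]_d) : R :=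
  Num.sqrt (\sum_i x ord0 i ^+ 2).

Definition eball (R : realType) (d : nat) (x : 'rV[R]_d) (r : R) :
  set 'rV[R]_d := [set y | enorm (y - x) < r].

(* Meant for [0 < alpha < 2] and [alpha < d < 2 * alpha], which holds for every
   [alpha] slightly above [d / 2] when [d] is 1 or 2.
   [(0 `^ s)^-1 = 0] for [s != 0] instead of [+oo]; this only affects the
   integrand on the diagonal [x = y], a null set. *)
Definition rollnik_norm (R : realType) (d : nat) (alpha : R) (V : 'rV[R]_d -> R) :
    \bar R :=
  sqrte (\int[lebesgue_measureRd R d]_y \int[lebesgue_measureRd R d]_x
    (`|V x| * `|V y| / enorm (x - y) `^ (2 * (d%:R - alpha)))%:E)%E.

(* Main.v *)
(* The exponent of the kernel is [2 (d - alpha)], which increases to the critical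
   value [d] as [alpha] decreases to [d / 2]. If [|V| > eps] a.e. on a ball, then
   for every [y] in a smaller cube the dyadic shell at distance about [2^-k] from
   [y] contributes to the inner integral an amount comparable to
   [2^(-k (2 alpha - d))], which tends to [1] for each fixed [k]. Hence, for every
   [n], the double integral is eventually at least a fixed multiple of [n]. All
   lower bounds only involve simple functions, so measurability of the kernel is
   never needed. *)

Require Import Defs.
From mathcomp Require Import all_boot all_order all_algebra.
From mathcomp Require Import all_classical all_reals all_analysis.
From mathcomp Require Import measurable_realfun ring lra.

Set Implicit Arguments.
Unset Strict Implicit.

Import Order.TTheory GRing.Theory Num.Theory.
Import numFieldNormedType.Exports.
Local Open Scope classical_set_scope.
Local Open Scope ring_scope.

(** * Measurability of boxes *)

(** The hyperplane [x_i = c] cuts every box of a cover into two boxes whose volumes add up.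
    Prescribing [H] only off the hyperplane treats open and closed half-spaces at once. *)
Lemma caratheodory_halfspace (R : realType) (d : nat) (i : 'I_d) (c : R)
    (H : set 'rV[R]_d) :
  (forall x : 'rV[R]_d, x ord0 i < c -> H x) ->
  (forall x : 'rV[R]_d, H x -> x ord0 i <= c) ->
  (@lebesgue_outer R d).-caratheodory H.
Proof.
move=> ltH Hle; apply: le_caratheodory_measurable => X.
apply: le_ereal_inf_tmp => _ [P [a [b [[ab XU] ->]]]].
(* [m k] is [c] clamped to the [i]-th side of box [k]; a box on one side of the hyperplane is split
   into itself and a degenerate box of volume 0. *)
pose m k := Num.max (a k ord0 i) (Num.min (b k ord0 i) c).
have am k : a k ord0 i <= m k by rewrite le_max lexx.
have mb k : m k <= b k ord0 i by rewrite ge_max ab ge_min lexx.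
pose a' k : 'rV[R]_d := \row_j (if j == i then m k else a k ord0 j).
pose b' k : 'rV[R]_d := \row_j (if j == i then m k else b k ord0 j).
have ab' k j : a k ord0 j <= b' k ord0 j.
  by rewrite mxE; case: eqP => [->|_]; rewrite ?am ?ab.
have a'b k j : a' k ord0 j <= b k ord0 j.
  by rewrite mxE; case: eqP => [->|_]; rewrite ?mb ?ab.
have vol k : ((box_volume (a k) (b k))%:E =
    (box_volume (a k) (b' k))%:E + (box_volume (a' k) (b k))%:E)%E.
  have volD (u v : 'rV[R]_d) : box_volume u v =
      (v ord0 i - u ord0 i) * \prod_(j | j != i) (v ord0 j - u ord0 j).
    by rewrite /box_volume (bigD1 i).
  have -> : box_volume (a k) (b' k) = (m k - a k ord0 i) *
      \prod_(j | j != i) (b k ord0 j - a k ord0 j).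
    rewrite volD mxE eqxx; congr (_ * _).
    by apply: eq_bigr => j /negPf ji; rewrite mxE ji.
  have -> : box_volume (a' k) (b k) = (b k ord0 i - m k) *
      \prod_(j | j != i) (b k ord0 j - a k ord0 j).
    rewrite volD mxE eqxx; congr (_ * _).
    by apply: eq_bigr => j /negPf ji; rewrite mxE ji.
  by rewrite volD -EFinD; congr EFin; ring.
have vol_ge0 (u v : 'rV[R]_d) : (forall j, u ord0 j <= v ord0 j) ->
    (0 <= (box_volume u v)%:E)%E.
  by move=> uv; rewrite lee_fin; apply: prodr_ge0 => j _; rewrite subr_ge0.
rewrite (eq_eseriesr (fun k _ => vol k)) nneseriesD; last 2 first.
- by move=> k _ _; exact: vol_ge0.
- by move=> k _ _; exact: vol_ge0.
apply: leeD; apply: ereal_inf_lbound.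
- exists P, a, b'; split => //; split => // x [Xx /Hle xc].
  have [k Pk bx] := XU x Xx; exists k => // j; have /andP[ax xb] := bx j.
  rewrite ax/= mxE; case: eqP => // ji; subst j.
  by rewrite le_max le_min xb xc orbT.
- exists P, a', b; split => //; split => // x [Xx nHx].
  have cx : c <= x ord0 i by rewrite leNgt; apply/negP => /ltH.
  have [k Pk bx] := XU x Xx; exists k => // j; have /andP[ax xb] := bx j.
  rewrite xb andbT mxE; case: eqP => // ji; subst j.
  by rewrite ge_max ax ge_min cx orbT.
Qed.

Lemma measurable_box (R : realType) (d : nat) (a b : 'rV[R]_d) :
  measurable (box a b : set (lebesgueRd R d)).
Proof.
have -> : box a b = \bigcap_(i in [set: 'I_d])
    (~` [set x : 'rV[R]_d | x ord0 i < a ord0 i] `&`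
     [set x : 'rV[R]_d | x ord0 i <= b ord0 i]).
  apply/seteqP; split => x /= bx i.
    by move=> _; have /andP[ax xb] := bx i; split => //=; apply/negP; rewrite -leNgt.
  by have [/negP + xb] := bx i I; rewrite -leNgt => ->.
apply: fin_bigcap_measurable => // i _.
apply: (@measurableI _ (lebesgueRd R d)); [apply: (@measurableC _ (lebesgueRd R d))|].
  by apply: (@caratheodory_halfspace _ _ i (a ord0 i)) => // x /ltW.
by apply: (@caratheodory_halfspace _ _ i (b ord0 i)) => // x /ltW.
Qed.

(** * Volume as a lower bound for the outer measure of a box *)

(* Slices at a fixed last coordinate [t] are covered by the slices of the boxes
   meeting it; the induction hypothesis is then integrated over [t]. *)
Lemma le_volume_cover (R : realType) (n : nat) (A B : nat -> R) (P : pred nat)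
    (a b : nat -> nat -> R) :
  (forall i, A i <= B i) -> (forall k i, a k i <= b k i) ->
  (forall x : nat -> R, (forall i, (i < n)%N -> A i <= x i <= B i) ->
     exists2 k, P k & forall i, (i < n)%N -> a k i <= x i <= b k i) ->
  ((\prod_(i < n) (B i - A i))%:E <=
     \sum_(k <oo | P k) (\prod_(i < n) (b k i - a k i))%:E)%E.
Proof.
move=> AB ab; elim: n P => [P cov|n IH P cov].
  (* In dimension 0 every volume is the empty product 1, so it suffices that some index satisfies
     [P]. *)
  have [k Pk _] := cov A (fun i => ltac:(by [])).
  rewrite (eq_eseriesr (g := fun=> 1%E)) => [|l _]; last by rewrite big_ord0.
  by rewrite big_ord0 (nneseriesD1 _ Pk)// leeDl// nneseries_ge0.
pose v k := \prod_(i < n) (b k i - a k i).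
have v0 k : 0 <= v k by apply: prodr_ge0 => i _; rewrite subr_ge0.
pose I k : set (measurableTypeR R) := `[a k n, b k n]%classic.
pose f k (t : measurableTypeR R) : \bar R :=
  if P k then ((v k)%:E * (\1_(I k) t)%:E)%E else 0%E.
have f0 k t : (0 <= f k t)%E.
  by rewrite /f; case: ifP => // _; rewrite mule_ge0// lee_fin.
have mf k : measurable_fun setT (f k).
  rewrite /f; case: (P k) => //; apply: measurable_funeM.
  by apply/measurable_EFinP; apply: measurable_indic; exact: measurable_itv.
pose D : set (measurableTypeR R) := `[A n, B n]%classic.
have mD : measurable D by exact: measurable_itv.
have mI k : measurable (I k) by exact: measurable_itv.
have muitv (x y : R) : x <= y -> lebesgue_measure `[x, y]%classic = (y - x)%:E.
  rewrite lebesgue_measure_itv /= lte_fin le_eqVlt => /predU1P[->|->//].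
  by rewrite ltxx subrr.
have slice t : D t -> ((\prod_(i < n) (B i - A i))%:E <= \sum_(k <oo) f k t)%E.
  rewrite /D /= in_itv /= => ADB.
  (* Only the boxes whose last side contains [t] are kept, which is why the induction is over all
     [P]. *)
  apply: le_trans (IH (fun k => P k && (a k n <= t <= b k n)) _) _.
    move=> x Hx.
    have [i iS|k Pk Hk] := cov (fun i => if i == n then t else x i).
      case: eqP => [->//|/eqP ni]; apply: Hx.
      by rewrite ltn_neqAle ni -ltnS.
    exists k.
      by rewrite Pk; have := Hk n (ltnSn n); rewrite eqxx.
    move=> i ni; have := Hk i (ltnW ni).
    by rewrite ltn_eqF.
  rewrite eseries_mkcond; apply: lee_nneseries => k _.
    by move=> _; case: ifP => // _; rewrite lee_fin; exact: v0.
  rewrite /f indicE /I; case: (P k) => //=.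
  case: ifP => [tk|_]; last by rewrite mule_ge0// lee_fin.
  by rewrite mem_set ?mule1//= in_itv.
have vD : (\int[lebesgue_measure]_(t in D) (\prod_(i < n) (B i - A i))%:E =
    (\prod_(i < n.+1) (B i - A i))%:E)%E.
  rewrite integral_cst// big_ord_recr /= EFinM.
  by congr (_ * _)%E; exact: muitv.
rewrite -vD; apply: (@le_trans _ _
    (\int[lebesgue_measure]_(t in D) \sum_(k <oo) f k t)%E).
  apply: ge0_le_integral => //.
  - by move=> t _; rewrite lee_fin; apply: prodr_ge0 => i _; rewrite subr_ge0.
  - apply: (ge0_emeasurable_sum (P := xpredT)) => [k t _ _|k _]; first exact: f0.
    apply: measurable_funTS; exact: mf.
(* After exchanging sum and integral, the [k]-th term is [v k] times the length of [I k]&[D], at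
   most the volume of box [k]. *)
rewrite integral_nneseries//; last by move=> k; apply: measurable_funTS; exact: mf.
rewrite [leRHS]eseries_mkcond; apply: lee_nneseries => k _.
  by move=> _; apply: integral_ge0.
rewrite /f; case: (P k); last by rewrite integral0.
rewrite ge0_integralZl_EFin//; last first.
  by apply/measurable_EFinP; apply: measurable_indic; exact: measurable_itv.
rewrite integral_indic// big_ord_recr /= EFinM.
apply: lee_wpmul2l; first by rewrite lee_fin.
apply: (@le_trans _ _ (lebesgue_measure (I k))).
  by apply: le_measure; rewrite ?inE//; exact: measurableI.
by rewrite le_eqVlt; apply/orP; left; apply/eqP; exact: muitv.
Qed.

(** Padding row vectors with zeros turns this into [le_volume_cover], whose sequences indexed by
    [nat] make dropping the last coordinate immediate. *)
Lemma box_volume_le_outer (R : realType) (d : nat) (u v : 'rV[R]_d) :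
  (forall i, u ord0 i <= v ord0 i) ->
  ((box_volume u v)%:E <= lebesgue_outer (box u v))%E.
Proof.
move=> uv; apply: le_ereal_inf_tmp => _ [P [a [b [[ab XU] ->]]]].
pose ext (w : 'rV[R]_d) (i : nat) : R :=
  if insub i is Some j then w ord0 j else 0.
have extE w (i : 'I_d) : ext w i = w ord0 i by rewrite /ext valK.
have le_ext (w w' : 'rV[R]_d) : (forall i, w ord0 i <= w' ord0 i) ->
    forall i, ext w i <= ext w' i.
  by move=> ww i; rewrite /ext; case: insubP.
have volE w w' : box_volume w w' = \prod_(i < d) (ext w' i - ext w i).
  by apply: eq_bigr => i _; rewrite !extE.
rewrite volE (eq_eseriesr (fun k _ => congr1 EFin (volE (a k) (b k)))).
apply: (@le_volume_cover _ _ _ _ _ (ext \o a) (ext \o b)).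
- exact: le_ext.
- by move=> k; exact: le_ext.
- move=> x Hx.
  have [|k Pk bx] := XU (\row_i x i).
    by move=> i; rewrite mxE; have := Hx i (ltn_ord i); rewrite !extE.
  exists k => // i id; have := bx (Ordinal id).
  by rewrite mxE /= -!extE.
Qed.

(** * Lower bounds for integrals by simple functions *)

(* Unlike [ge0_le_integral], this requires no measurability: the integral of a
   nonnegative function is a supremum over the simple functions below it. *)
Lemma le_integral_nonmeasurable (disp : measure_display)
    (T : measurableType disp) (R : realType)
    (mu : {measure set T -> \bar R}) (f g : T -> \bar R) :
  (forall x, 0 <= f x)%E -> (forall x, f x <= g x)%E ->
  (\int[mu]_x f x <= \int[mu]_x g x)%E.
Proof.
move=> f0 fg; have g0 x : (0 <= g x)%E by exact: le_trans (f0 x) (fg x).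
rewrite !ge0_integralTE//; apply: ereal_sup_le => _ [h hf <-].
by exists h => // x; exact: le_trans (hf x) (fg x).
Qed.

(** By disjointness, [g] dominates the simple function with value [c i] on [E i] and 0 elsewhere. *)
Lemma sum_measure_le_integral (disp : measure_display)
    (T : measurableType disp) (R : realType)
    (mu : {measure set T -> \bar R}) (I : finType) (E : I -> set T)
    (c : I -> R) (g : T -> \bar R) :
  (forall i, measurable (E i)) -> trivIset setT E ->
  (forall i, 0 <= c i) -> (forall x, 0 <= g x)%E ->
  (forall i x, E i x -> (c i)%:E <= g x)%E ->
  (\sum_i (c i)%:E * mu (E i) <= \int[mu]_x g x)%E.
Proof.
move=> mE trE c0 g0 cg.
pose f i x : \bar R := ((c i)%:E * (\1_(E i) x)%:E)%E.
have f0 i x : (0 <= f i x)%E by rewrite mule_ge0// lee_fin.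
have mf i : measurable_fun setT (fun x => (\1_(E i) x)%:E : \bar R).
  by apply/measurable_EFinP; exact: measurable_indic.
have intf i : (\int[mu]_x f i x = (c i)%:E * mu (E i))%E.
  by rewrite /f ge0_integralZl_EFin// integral_indic// setIT.
rewrite -(eq_bigr _ (fun i _ => intf i)) -ge0_integral_sum//; last first.
  by move=> i; apply: measurable_funeM; exact: mf.
apply: le_integral_nonmeasurable => x.
  by apply: sume_ge0 => i _; exact: f0.
have [[i Eix]|nE] := pselect (exists i, E i x); last first.
  rewrite big1// => i _; rewrite /f indicE memNset ?mule0//.
  by move=> Eix; apply: nE; exists i.
rewrite (bigD1 i)//= [X in (_ + X)%E]big1 ?adde0.
  by rewrite /f indicE mem_set// mule1 cg.
move=> j /eqP ji; rewrite /f indicE memNset ?mule0// => Ejx.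
by apply: ji; apply: trE => //; exists x.
Qed.

(** * Estimates for the Euclidean norm, null sets and powers *)

Lemma enorm_le (R : realType) (d : nat) (z : 'rV[R]_d) (t : R) :
  0 <= t -> (forall i, `|z ord0 i| <= t) -> enorm z <= d%:R * t.
Proof.
move=> t0 zt; have dt0 : 0 <= d%:R * t by rewrite mulr_ge0.
rewrite /enorm -(ger0_norm dt0) -sqrtr_sqr ler_sqrt ?sqr_ge0//.
apply: (@le_trans _ _ (\sum_(i < d) t ^+ 2)).
  by apply: ler_sum => i _; rewrite -real_normK ?num_real// ler_sqr ?nnegrE.
rewrite sumr_const card_ord -[leLHS]mulr_natl exprMn.
apply: ler_wpM2r; first exact: sqr_ge0.
(* The sharp factor is the square root of [d]; the cruder [d] comes from [d <= d ^ 2]. *)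
by rewrite -natrX ler_nat; case: (d) => // n; rewrite leq_pmulr.
Qed.

Lemma coord_le_enorm (R : realType) (d : nat) (z : 'rV[R]_d) (i : 'I_d) :
  `|z ord0 i| <= enorm z.
Proof.
rewrite -sqrtr_sqr ler_wsqrtr// (bigD1 i)//= lerDl.
by apply: sumr_ge0 => j _; exact: sqr_ge0.
Qed.

(** The box is covered by its part in [P] and the exceptional null set, so subadditivity of the
    outer measure applies. *)
Lemma box_volume_le_ae (R : realType) (d : nat) (P : 'rV[R]_d -> Prop)
    (r : R) (x u v : 'rV[R]_d) :
  {ae lebesgue_measureRd R d, forall y, eball x r y -> P y} ->
  (forall i, u ord0 i <= v ord0 i) -> box u v `<=` eball x r ->
  ((box_volume u v)%:E <= lebesgue_measureRd R d (box u v `&` [set y | P y]))%E.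
Proof.
move=> [N [_ N0 PN]] uv uvx; apply: (le_trans (box_volume_le_outer uv)).
rewrite -[leRHS]adde0 -N0.
apply: (le_trans _ (outer_measureU2 (@lebesgue_outer R d) _ _)).
apply: le_lebesgue_outer => y uvy.
have [Py|nPy] := pselect (P y); [by left|right].
by apply: PN => /= /(_ (uvx _ uvy)).
Qed.

(** Write the power as an exponential and use [exp u >= 1 + u]; it remains to make
    [b (s - a) |ln t|] at most 1/2. *)
Lemma near_powR_ge_half (R : realType) (a b t : R) : 0 < t -> 0 < b ->
  \forall s \near a^'+, 2^-1 <= t `^ (b * (s - a)).
Proof.
(* The summand 1 keeps the denominator positive when [t = 1]. *)
move=> t0 b0; pose e := (2 * b * (1 + `|ln t|))^-1.
have den0 : 0 < 2 * b * (1 + `|ln t|).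
  by rewrite !mulr_gt0// ltr_pwDl.
near=> s.
have as_ : a < s by near: s; exact: nbhs_right_gt.
have sa : s < a + e by near: s; apply: nbhs_right_lt; rewrite ltrDl invr_gt0.
rewrite /powR gt_eqF//; apply: le_trans (expR_ge1Dx _).
have h : b * (s - a) * `|ln t| <= 2^-1.
  apply: (@le_trans _ _ (b * e * (1 + `|ln t|))).
    apply: ler_pM => //; first by rewrite mulr_ge0 ?ltW// subr_gt0.
      by rewrite ler_pM2l// lerBlDl ltW.
    by rewrite lerDr.
  suff -> : b * e * (1 + `|ln t|) = 2^-1 by [].
  by rewrite /e; field; rewrite !gt_eqF// ltr_pwDl.
have : - (b * (s - a) * `|ln t|) <= b * (s - a) * ln t.
  rewrite -mulrN; apply: ler_wpM2l; first by rewrite mulr_ge0 ?ltW// subr_gt0.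
  by rewrite lerNl ler_normr lexx orbT.
by move: h; lra.
Unshelve. all: by end_near. Qed.

(** * Dyadic boxes *)

(* Stands in for the dyadic shell around [y]; the factor [3 / 4], which exceeds
   [1 / 2], makes the boxes for distinct [k] disjoint. *)
Definition dyadic_box (R : realType) (d : nat) (y : 'rV[R]_d) (rho : R)
    (k : nat) : set 'rV[R]_d :=
  box (y + const_mx (3 / 4 * (rho / 2 ^+ k))) (y + const_mx (rho / 2 ^+ k)).

Section dyadic_box.
Variables (R : realType) (d : nat) (y : 'rV[R]_d) (rho : R).
Hypothesis rho_gt0 : 0 < rho.

Lemma dyadic_boxP k x : dyadic_box y rho k x ->
  forall i, 3 / 4 * (rho / 2 ^+ k) <= (x - y) ord0 i <= rho / 2 ^+ k.
Proof.
by move=> xk i; have := xk i; rewrite !mxE -lerBrDl lerBlDl.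
Qed.

Lemma dyadic_box_volume k :
  box_volume (y + const_mx (3 / 4 * (rho / 2 ^+ k)))
    (y + const_mx (rho / 2 ^+ k)) = (rho / 2 ^+ k / 4) ^+ d.
Proof.
rewrite /box_volume -[in RHS](card_ord d) -prodr_const.
by apply: eq_bigr => i _; rewrite !mxE; set h := rho / _; field.
Qed.

Lemma trivIset_dyadic_box : (0 < d)%N -> trivIset setT (dyadic_box y rho).
Proof.
move=> d0; apply: ltn_trivIset => m n nm; apply/seteqP; split => // x [xn xm].
have /andP[le_n _] := dyadic_boxP xn (Ordinal d0).
have /andP[_ le_m] := dyadic_boxP xm (Ordinal d0).
have h0 : 0 < rho / 2 ^+ n by rewrite divr_gt0// exprn_gt0.
have le_half : rho / 2 ^+ m <= rho / 2 ^+ n / 2.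
  rewrite -mulrA -invfM -exprSr ler_pM2l// lef_pV2 ?posrE ?exprn_gt0//.
  by rewrite ler_eXn2l// ltr1n.
by exfalso; lra.
Qed.

End dyadic_box.

(** * Lower bound for the double integral *)

Section rollnik_lower_bound.
Variables (R : realType) (d : nat) (V : 'rV[R]_d -> R).
Hypothesis d_gt0 : (0 < d)%N.
Hypothesis mV : measurable_fun [set: lebesgueRd R d] (V : lebesgueRd R d -> R).
Variables (eps r : R) (x0 : 'rV[R]_d).
Hypotheses (eps_gt0 : 0 < eps) (r_gt0 : 0 < r).
Hypothesis V_large :
  {ae lebesgue_measureRd R d, forall y, eball x0 r y -> eps < `|V y|}.

Let A : set (lebesgueRd R d) := [set y | eps < `|V y|].
(** Chosen so that sup-distance at most [2 * rho] from [x0] forces Euclidean distance at most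
    [r / 2]. This leaves room for a cube of side [rho] at [x0] and for the dyadic boxes around its
    points. *)
Let rho : R := r / (4 * d%:R).
(** Bounds [enorm (x - y)] for [x] in the [k]-th dyadic box around [y]. *)
Let t k : R := d%:R * (rho / 2 ^+ k).
(** Lower bound for the contribution of a single dyadic box, the same for all [k]. *)
Let c : R := eps ^+ 2 / 2 / (4 * d%:R) ^+ d.

Let measurable_A : measurable A.
Proof.
have -> : A = (fun x => `|V x|) @^-1` `]eps, +oo[%classic.
  by apply/seteqP; split => x /=; rewrite in_itv /= andbT.
rewrite -[X in measurable X]setTI.
by apply: measurableT_comp => //; exact: measurable_itv.
Qed.

Let d_gt0R : 0 < d%:R :> R. Proof. by rewrite ltr0n. Qed.

Let rho_gt0 : 0 < rho. Proof. by rewrite divr_gt0// mulr_gt0. Qed.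

Let h_gt0 k : 0 < rho / 2 ^+ k. Proof. by rewrite divr_gt0// exprn_gt0. Qed.

Let t_gt0 k : 0 < t k. Proof. by rewrite mulr_gt0. Qed.

Let h_le k : rho / 2 ^+ k <= rho.
Proof.
rewrite ler_pdivrMr ?exprn_gt0//; apply: ler_peMr; first exact: ltW.
by apply: exprn_ege1; rewrite ler1n.
Qed.

Let sub_eball (y : 'rV[R]_d) :
  (forall i, `|(y - x0) ord0 i| <= 2 * rho) -> eball x0 r y.
Proof.
move=> /(enorm_le (mulr_ge0 (ler0n _ 2) (ltW rho_gt0))) /le_lt_trans; apply.
have -> : d%:R * (2 * rho) = r / 2 by rewrite /rho; field; rewrite gt_eqF.
by rewrite ltr_pdivrMr// ltr_pMr// ltr1n.
Qed.

Let cube := box x0 (x0 + const_mx rho).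

Let cubeP y : cube y -> forall i, 0 <= (y - x0) ord0 i <= rho.
Proof.
move=> yQ i; have := yQ i; rewrite !mxE subr_ge0 => /andP[->].
by rewrite lerBlDl.
Qed.

Let kernel alpha (x y : 'rV[R]_d) : \bar R :=
  (`|V x| * `|V y| / enorm (x - y) `^ (2 * (d%:R - alpha)))%:E.

Let kernel_ge0 alpha x y : (0 <= kernel alpha x y)%E.
Proof. by rewrite lee_fin !mulr_ge0// invr_ge0 powR_ge0. Qed.

Let kernel_ge alpha x y k : alpha <= d%:R -> A x -> A y -> dyadic_box y rho k x ->
  ((eps ^+ 2 / t k `^ (2 * (d%:R - alpha)))%:E <= kernel alpha x y)%E.
Proof.
move=> ad Ax Ay /dyadic_boxP xyk.
have xy_gt0 i : 0 < (x - y) ord0 i.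
  by case/andP: (xyk i) => + _; apply: lt_le_trans; rewrite mulr_gt0// divr_gt0.
have s_ge0 : 0 <= 2 * (d%:R - alpha) by rewrite mulr_ge0// subr_ge0.
(* Strict positivity keeps [x] off the diagonal, where the inverse may take its default value 0. *)
have exy_gt0 : 0 < enorm (x - y).
  apply: lt_le_trans (coord_le_enorm _ (Ordinal d_gt0)).
  by rewrite normr_gt0 gt_eqF.
have exy_le : enorm (x - y) <= t k.
  apply: enorm_le; first exact: ltW.
  by move=> i; rewrite gtr0_norm//; case/andP: (xyk i).
rewrite lee_fin; apply: ler_pM; rewrite ?sqr_ge0 ?invr_ge0 ?powR_ge0//.
  by rewrite expr2; apply: ler_pM; rewrite ?ltW.
rewrite lef_pV2 ?posrE ?powR_gt0//.
by apply: ge0_ler_powR => //; rewrite nnegrE ltW.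
Qed.

(** The box has side [t k / (4 d)], so volume times kernel bound is [eps ^+ 2 / (4 d) ^+ d] times
    [t k] to the power [d - 2 (d - alpha) = 2 (alpha - d / 2)]. By hypothesis this power is at least
    1/2. *)
Let scaled_volume alpha k : 2^-1 <= t k `^ (2 * (alpha - d%:R / 2)) ->
  c <= eps ^+ 2 / t k `^ (2 * (d%:R - alpha)) * (rho / 2 ^+ k / 4) ^+ d.
Proof.
move=> tk.
have -> : rho / 2 ^+ k / 4 = t k / (4 * d%:R).
  by rewrite /t; set h := rho / _; field; rewrite gt_eqF.
rewrite expr_div_n -(powR_mulrn _ (ltW (t_gt0 k))) /c.
have -> : eps ^+ 2 / t k `^ (2 * (d%:R - alpha)) *
    (t k `^ d%:R / (4 * d%:R) ^+ d) =
    eps ^+ 2 * t k `^ (2 * (alpha - d%:R / 2)) / (4 * d%:R) ^+ d.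
  have -> : 2 * (alpha - d%:R / 2) = d%:R - 2 * (d%:R - alpha) by field.
  rewrite powRB ?(gt_eqF (t_gt0 k)) ?implybT//.
  by rewrite -!mulrA; congr (_ * (_ * _)); rewrite mulrCA.
apply: ler_wpM2r; first by rewrite invr_ge0 exprn_ge0// mulr_ge0.
by apply: ler_wpM2l => //; exact: sqr_ge0.
Qed.

Let inner_integral_ge alpha n y : alpha <= d%:R ->
  (forall k : 'I_n, 2^-1 <= t k `^ (2 * (alpha - d%:R / 2))) ->
  cube y -> A y ->
  ((n%:R * c)%:E <= \int[lebesgue_measureRd R d]_x kernel alpha x y)%E.
Proof.
move=> ad tn yQ Ay.
pose E (k : 'I_n) : set (lebesgueRd R d) := dyadic_box y rho k `&` A.
pose a (k : 'I_n) := eps ^+ 2 / t k `^ (2 * (d%:R - alpha)).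
have a_ge0 k : 0 <= a k by rewrite divr_ge0 ?sqr_ge0 ?powR_ge0.
apply: (@le_trans _ _ (\sum_k (a k)%:E * lebesgue_measureRd R d (E k))%E).
  apply: (@le_trans _ _ (\sum_(k < n) c%:E)%E).
    by rewrite sumEFin lee_fin sumr_const card_ord mulr_natl.
  apply: lee_sum => k _.
  apply: (@le_trans _ _ ((a k)%:E * ((rho / 2 ^+ k / 4) ^+ d)%:E)%E).
    by rewrite -EFinM lee_fin; exact: scaled_volume.
  apply: lee_wpmul2l; first by rewrite lee_fin.
  rewrite -(dyadic_box_volume y); apply: (box_volume_le_ae V_large).
    move=> i; rewrite !mxE lerD2l ler_piMl ?ltW//.
    by rewrite ltr_pdivrMr// mul1r ltr_nat.
  (* The coordinates of [y - x0] and of [x - y] lie between 0 and [rho], so those of [x - x0] lie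
     between 0 and [2 * rho]. *)
  move=> x /dyadic_boxP xk; apply: sub_eball => i.
  have /andP[xy0 xy] := xk i; have /andP[yx0 yx] := cubeP yQ i.
  have := h_le k; have := h_gt0 k; move: xy0 xy yx0 yx; rewrite !mxE.
  by move=> *; rewrite ger0_norm; lra.
apply: sum_measure_le_integral => //.
- by move=> k; apply: measurableI => //; exact: measurable_box.
- apply/trivIsetP => i j _ _ ij; apply/seteqP; split => // x [[xi _] [xj _]].
  have /trivIsetP/(_ i j I I) := @trivIset_dyadic_box _ _ y _ rho_gt0 d_gt0.
  by move=> /(_ ij) /seteqP[+ _]; apply; split.
- by move=> k x [xk Ax]; exact: kernel_ge.
Qed.

Lemma double_integral_ge alpha n : alpha <= d%:R ->
  (forall k : 'I_n, 2^-1 <= t k `^ (2 * (alpha - d%:R / 2))) ->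
  ((n%:R * c * rho ^+ d)%:E <= \int[lebesgue_measureRd R d]_y
     \int[lebesgue_measureRd R d]_x kernel alpha x y)%E.
Proof.
move=> ad tn.
have c_ge0 : 0 <= c by rewrite !divr_ge0 ?sqr_ge0// exprn_ge0// mulr_ge0.
(* A family with one member: the inner integral is at least [n c] on this set, whose measure is at
   least [rho ^+ d]. *)
pose E (_ : unit) : set (lebesgueRd R d) := cube `&` A.
pose M (_ : unit) := n%:R * c.
apply: (@le_trans _ _ (\sum_i (M i)%:E * lebesgue_measureRd R d (E i))%E).
  rewrite (bigD1 tt)//= big1 ?adde0 => [|[]//].
  rewrite EFinM; apply: lee_wpmul2l; first by rewrite lee_fin mulr_ge0.
  have -> : rho ^+ d = box_volume x0 (x0 + const_mx rho).
    rewrite /box_volume -[in LHS](card_ord d) -prodr_const.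
    by apply: eq_bigr => i _; rewrite !mxE; ring.
  apply: (box_volume_le_ae V_large).
    by move=> i; rewrite !mxE lerDl ltW.
  move=> y /cubeP yQ; apply: sub_eball => i.
  have /andP[y0 y1] := yQ i; rewrite ger0_norm//.
  by have := rho_gt0; lra.
apply: sum_measure_le_integral => //.
- by move=> u; apply: measurableI => //; exact: measurable_box.
- by move=> [] [].
- by move=> u; rewrite mulr_ge0.
- by move=> y; exact: integral_ge0.
- by move=> u y [yQ Ay]; exact: inner_integral_ge.
Qed.

End rollnik_lower_bound.

(** * Divergence of the norm and conclusion *)

Lemma limf_einf_pinfty (T : choiceType) (X : filteredType T) (R : realType)
    (f : X -> \bar R) (F : set (set X)) :
  (forall M, 0 < M -> F [set x | (M%:E <= f x)%E]) -> limf_einf f F = +oo%E.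
Proof.
move=> fF; apply/eqyP => M M0; rewrite leeNr.
(* The lower limit is minus an infimum, over members of [F], of suprema of [- f]; the member where
   [f >= M] gives a supremum at most [- M]. *)
apply: le_trans (ereal_inf_lbound _) _.
  by exists [set x | (M%:E <= f x)%E]; [exact: fF M0|reflexivity].
by apply: ge_ereal_sup => _ [x Mx <-]; rewrite leeN2.
Qed.

Lemma rollnik_norm_pinfty (R : realType) (d : nat) (V : 'rV[R]_d -> R)
    (eps r : R) (x : 'rV[R]_d) : (0 < d)%N ->
  measurable_fun [set: lebesgueRd R d] (V : lebesgueRd R d -> R) ->
  0 < eps -> 0 < r ->
  {ae lebesgue_measureRd R d, forall y, eball x r y -> eps < `|V y|} ->
  limf_einf (fun alpha : R => rollnik_norm alpha V) ((d%:R / 2 : R)^'+) = +oo%E.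
Proof.
move=> d0 mV eps0 r0 aeV; apply: limf_einf_pinfty => M M0.
have dR0 : 0 < d%:R :> R by rewrite ltr0n.
have rho0 : 0 < r / (4 * d%:R) by rewrite divr_gt0// mulr_gt0.
pose c := eps ^+ 2 / 2 / (4 * d%:R) ^+ d * (r / (4 * d%:R)) ^+ d.
have c0 : 0 < c by rewrite mulr_gt0 ?exprn_gt0// !divr_gt0 ?exprn_gt0// mulr_gt0.
(* The norm is the square root of the double integral, so [n] must satisfy [n c >= M ^+ 2]; it is
   fixed before [alpha]. *)
pose n := Num.bound (M ^+ 2 / c).
have Mn : M ^+ 2 <= n%:R * c.
  rewrite -ler_pdivrMr//; apply/ltW/archi_boundP.
  by rewrite divr_ge0 ?sqr_ge0// ltW.
near=> alpha => /=.
have -> : M%:E = sqrte (M ^+ 2)%:E by rewrite /= sqrtr_sqr gtr0_norm.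
rewrite /rollnik_norm lee_sqrt; last first.
  apply: integral_ge0 => y _; apply: integral_ge0 => z _.
  by rewrite lee_fin !mulr_ge0// invr_ge0 powR_ge0.
apply: (@le_trans _ _ (n%:R * c)%:E); first by rewrite lee_fin.
rewrite /c mulrA; apply: (double_integral_ge d0 mV eps0 r0 aeV).
  by near: alpha; apply: nbhs_right_le; rewrite ltr_pdivrMr// ltr_pMr// ltr1n.
(* Only the finitely many scales [k < n] are involved, so one neighbourhood serves all of them. *)
near: alpha; apply: filter_forall => k; apply: near_powR_ge_half => //.
by rewrite mulr_gt0// divr_gt0// exprn_gt0.
Unshelve. all: by end_near. Qed.

Theorem proposition3p10 (R : realType) (d : nat) (V : 'rV[R]_d -> R)
    (hd : d = 1%N \/ d = 2%N)
    (mV : measurable_fun [set: lebesgueRd R d] (V : lebesgueRd R d -> R))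
    (hV : (limf_einf (fun alpha : R => rollnik_norm alpha V) ((d%:R / 2 : R)^'+)
            < +oo)%E) :
  (forall (eps r : R) (x : 'rV[R]_d), 0 < eps -> 0 < r ->
     ~ {ae lebesgue_measureRd R d, forall y, eball x r y -> eps < `|V y|}) /\
  (continuous V -> forall x, V x = 0).
Proof.
have d0 : (0 < d)%N by case: hd => ->.
have not_large (eps r : R) (x : 'rV[R]_d) : 0 < eps -> 0 < r ->
    ~ {ae lebesgue_measureRd R d, forall y, eball x r y -> eps < `|V y|}.
  by move=> eps0 r0 aeV; move: hV; rewrite (rollnik_norm_pinfty d0 mV eps0 r0 aeV).
split=> // cV x; apply/eqP/negPn/negP => Vx0.
have Vx_gt0 : 0 < `|V x| by rewrite normr_gt0.
have : \forall y \near x, `|V x| / 2 < `|V y|.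
  have /cvg_norm/cvgr_gt := cV x; apply.
  by rewrite ltr_pdivrMr// ltr_pMr// ltr1n.
move=> /nbhs_ballP[r /= r0 xr].
apply: (not_large (`|V x| / 2) r x _ r0); first by rewrite divr_gt0.
(* The neighbourhood [xr] is a sup-norm ball; it contains the Euclidean ball of the same radius. *)
apply: aeW => y yr; apply: xr; split=> // i j.
rewrite (ord1 i) /ball /= distrC; apply: le_lt_trans yr.
by have := coord_le_enorm (y - x) j; rewrite !mxE.
Qed.
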